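(* Let $T$ be any Erdős–Szekeres tableau of size $n$. Then $[T]=L(P(T))$, i.e. a linear order on $[n]$ arises from a sequence $A$ with $T(A)=T$ if and only if it is a linear extension of the order poset $P(T)$.
   Context: For a sequence $A=(a_1,\dots,a_n)$ of distinct real numbers, let $a_i^+$ (resp. $a_i^-$) be the length of the longest increasing (resp. decreasing) subsequence of $A$ ending at $a_i$; the Erdős–Szekeres tableau (EST) of $A$ is $T(A)=((a_i^+,a_i^-))_{i\le n}$. $\mathcal{T}_n$ is the set of all ESTs of sequences of length $n$. A sequence $A$ is identified with the linear order $<_A$ on $[n]=\{1,\dots,n\}$ given by $i<_A j$ iff $a_i<a_j$. For $T\in\mathcal{T}_n$, $[T]$ is the set of linear orders $<_A$ on $[n]$ with $T(A)=T$. The order poset $P(T)=([n],<_{P(T)})$ is defined by $i<_{P(T)}j$ iff $i<_A j$ for all $A\in[T]$. For a poset $P$ on a set $X$, $L(P)$ is the set of linear orders on $X$ extending $<_P$. *)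

(* Defs.v *)
From HB Require Import structures.
From mathcomp Require Import all_boot all_order all_algebra.
From mathcomp Require Import boolp classical_sets reals.

Set Implicit Arguments.
Unset Strict Implicit.
Unset Printing Implicit Defensive.

Import Order.TTheory GRing.Theory Num.Theory.
Local Open Scope ring_scope.
Local Open Scope classical_set_scope.

(* Orders are strict, as boolean relations. *)
Definition strict_order (X : Type) (r : rel X) : Prop :=
  irreflexive r /\ transitive r.

Definition strict_linear_order (X : Type) (r : rel X) : Prop :=
  strict_order r /\ forall x y : X, x <> y -> r x y || r y x.

Definition linear_extensions (X : Type) (P : rel X) : set (rel X) :=
  [set r | strict_linear_order r /\ subrel P r].

Section ErdosSzekeres.
Variables (R : realType) (n : nat).
Implicit Types (A : n.-tuple R) (T : n.-tuple (nat * nat)) (i j k : 'I_n).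

(* A subsequence is given by its set S of positions; the entries of A at S,
   read from left to right, are pairwise related by e. *)
Definition monotone_on (e : rel R) A (S : {set 'I_n}) : bool :=
  [forall j in S, forall k in S, (j < k)%N ==> e (tnth A j) (tnth A k)].

Definition ends_at i (S : {set 'I_n}) : bool :=
  (i \in S) && [forall j in S, (j <= i)%N].

Definition longest_ending_at (e : rel R) A i : nat :=
  \max_(S : {set 'I_n} | monotone_on e A S && ends_at i S) #|S|.

Definition longest_incr A i : nat := longest_ending_at <%R A i.
Definition longest_decr A i : nat := longest_ending_at >%R A i.

Definition EST A : n.-tuple (nat * nat) :=
  [tuple (longest_incr A i, longest_decr A i) | i < n].

Definition ESTs : set (n.-tuple (nat * nat)) :=
  [set EST A | A in [set A : n.-tuple R | uniq A]].

Definition seq_order A : rel 'I_n := fun i j => tnth A i < tnth A j.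

Definition EST_class T : set (rel 'I_n) :=
  [set seq_order A | A in [set A : n.-tuple R | uniq A /\ EST A = T]].

Definition order_poset T : rel 'I_n :=
  fun i j => `[< forall r, EST_class T r -> r i j >].

Lemma seq_order_strict_linear A : uniq A -> strict_linear_order (seq_order A).
Proof.
move=> uA; split=> [|i j /eqP nij]; first split.
- by move=> i; rewrite /seq_order ltxx.
- by move=> j i k; exact: lt_trans.
by rewrite /seq_order -neq_lt; move/tuple_uniqP: uA => /inj_eq->.
Qed.

(* For T not in ESTs, order_poset T is the full relation. *)
Lemma order_poset_strict T : ESTs T -> strict_order (order_poset T).
Proof.
move=> [A uA <-]; split=> [i|j i k /asboolP ij /asboolP jk].
  apply/asboolP => /(_ (seq_order A)) H.
  suff : seq_order A i i by rewrite /seq_order ltxx.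
  by apply: H; exists A.
apply/asboolP => r Er; move: (ij r Er) (jk r Er); case: Er => B [uB _] <-.
exact: lt_trans.
Qed.

End ErdosSzekeres.

Arguments ESTs : clear implicits.
Arguments EST_class R [n] T _.
Arguments order_poset R [n] T _ _.

(* Main.v *)
Require Import Defs.
From mathcomp Require Import all_boot all_order all_algebra.
From mathcomp Require Import boolp classical_sets reals.

(** The lengths [f i] of the longest increasing subsequences ending at [i] are
characterised by: for [i < j], [a_i < a_j] forces [f i < f j], and every [j]
with [f j > 1] has some [i < j] with [a_i < a_j] and [f i = f j - 1]. By
contraposition, the first condition says [a_j < a_i] whenever [i < j] and
[f j <= f i]. It makes the level set [f = f j - 1] decreasing, so in the second
condition [i] can be taken to be the last index before [j] in that level set,
which depends on [f] only. The same holds for decreasing subsequences. Hence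
[[T]] is the set of linear orders satisfying a list of comparisons between
pairs, all of which hold in [P(T)]. *)

Set Implicit Arguments.
Unset Strict Implicit.
Unset Printing Implicit Defensive.

Import Order.TTheory GRing.Theory Num.Theory.

Section Rank.
Variable n : nat.
Implicit Types (E r : rel 'I_n) (f g : 'I_n -> nat) (i j k : 'I_n).

(** Stated for an arbitrary relation, so that one argument serves increasing subsequences ([E] a
    linear order) and decreasing ones ([E] its converse). *)
Definition rank_spec E f : Prop :=
  [/\ forall i, 0 < f i,
      forall i j, i < j -> E i j -> f i < f j
    & forall j, 1 < f j -> exists i, [/\ i < j, E i j & (f i).+1 = f j]].

(** Induction on the position: a step from [j] back to its predecessor for [f] lowers [f] by exactly
    one and [g] by at least one. *)
Lemma rank_spec_le E f g : rank_spec E f -> rank_spec E g -> forall j, f j <= g j.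
Proof.
move=> [_ _ f_pred] [g_gt0 g_mono _] j.
have [m] := ubnP (nat_of_ord j); elim: m j => // m IHm j le_jm.
have [f_le1|/f_pred[i [lt_ij Eij <-]]] := leqP (f j) 1.
  exact: leq_trans f_le1 (g_gt0 j).
apply: leq_ltn_trans (g_mono _ _ lt_ij Eij).
by apply: IHm; apply: leq_trans lt_ij _.
Qed.

Lemma rank_spec_uniq E f g : rank_spec E f -> rank_spec E g -> f =1 g.
Proof.
by move=> Ef Eg j; apply/eqP; rewrite eqn_leq !(@rank_spec_le E).
Qed.

(** Here [C] is to be [[T]] or the set of converses of its members. Each comparison needed for [r]
    is shown to hold throughout [C]; a single member of [C] shows which levels of [f] are inhabited
    before [j]. *)
Lemma rank_spec_linear_extension (C : set (rel 'I_n)) f r :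
  (exists E, C E) ->
  (forall E, C E -> strict_linear_order E /\ rank_spec E f) ->
  strict_linear_order r ->
  (forall i j, (forall E, C E -> E i j) -> r i j) -> rank_spec r f.
Proof.
move=> [E0 CE0] C_spec [[r_irr r_tr] _] C_r.
have C_level E i j : C E -> i < j -> f j <= f i -> E j i.
  move=> /C_spec[[_ E_tot] [_ f_mono _]] lt_ij le_f.
  have nij : i <> j by move=> eq_ij; rewrite eq_ij ltnn in lt_ij.
  case/orP: (E_tot i j nij) => // /(f_mono _ _ lt_ij).
  by rewrite ltnNge le_f.
have [_ [f_gt0 _ f_pred0]] := C_spec _ CE0; split=> // [i j lt_ij r_ij|j f_gt1].
  rewrite ltnNge; apply/negP => le_f.
  have r_ji : r j i by apply: C_r => E CE; apply: C_level.
  by have := r_tr _ _ _ r_ij r_ji; rewrite r_irr.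
have [i0 [lt_i0j _ f_i0]] := f_pred0 j f_gt1.
(* [Q] does not mention [E], so its last index [i] is one witness for all members of [C]. *)
pose Q i := (i < j) && ((f i).+1 == f j).
have Qi0 : Q i0 by rewrite /Q lt_i0j f_i0 eqxx.
case: (@arg_maxnP _ i0 Q (@nat_of_ord n) Qi0) => i /andP[lt_ij /eqP f_i] i_max.
exists i; split=> //; apply: C_r => E CE.
have [[[_ E_tr] _] [_ _ f_pred]] := C_spec _ CE.
have [k [lt_kj E_kj f_k]] := f_pred j f_gt1.
have le_ki : k <= i by apply: i_max; rewrite /Q lt_kj f_k eqxx.
(* The predecessor [k] depends on [E]. If it is not [i], it precedes [i] on the same level, so
   [E i k], and [E k j] gives [E i j]. *)
have [/val_inj <- //|nki] := eqVneq (k : nat) i.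
apply: E_tr E_kj; apply: C_level => //; first by rewrite ltn_neqAle nki.
by rewrite -ltnS f_i f_k.
Qed.

End Rank.

Lemma strict_linear_order_converse (X : Type) (r : rel X) :
  strict_linear_order r -> strict_linear_order (fun x y => r y x).
Proof.
move=> [[r_irr r_tr] r_tot]; split; last by move=> x y /r_tot; rewrite orbC.
by split=> // y x z r_yx r_zy; apply: r_tr r_zy r_yx.
Qed.

Section Longest.
Variables (R : realType) (n : nat) (e : rel R) (A : n.-tuple R).
Implicit Types (i j k : 'I_n) (S : {set 'I_n}).

Lemma monotone_onP S :
  reflect (forall j k, j \in S -> k \in S -> j < k -> e (tnth A j) (tnth A k))
          (monotone_on e A S).
Proof.
apply: (iffP forall_inP) => [S_mono j k jS kS lt_jk|S_mono j jS].
  by have /forall_inP/(_ k kS)/implyP := S_mono j jS; apply.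
by apply/forall_inP => k kS; apply/implyP; apply: S_mono.
Qed.

Lemma ends_atP i S :
  reflect (i \in S /\ forall j, j \in S -> j <= i) (ends_at i S).
Proof. by apply: (iffP andP) => -[iS /forall_inP]. Qed.

Lemma leq_longest_ending_at i S :
  monotone_on e A S -> ends_at i S -> #|S| <= longest_ending_at e A i.
Proof.
move=> S_mono S_end; rewrite /longest_ending_at.
by apply: (@leq_bigmax_cond _ _ (fun S : {set 'I_n} => #|S|)); rewrite S_mono.
Qed.

Lemma longest_ending_at_gt0 i : 0 < longest_ending_at e A i.
Proof.
rewrite -(cards1 i); apply: leq_longest_ending_at.
  by apply/monotone_onP => j k /set1P-> /set1P->; rewrite ltnn.
by apply/ends_atP; split=> [|j /set1P->]; rewrite ?set11.
Qed.

Lemma longest_ending_at_witness i :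
  exists S, [/\ monotone_on e A S, ends_at i S & #|S| = longest_ending_at e A i].
Proof.
pose P S := monotone_on e A S && ends_at i S.
have P_gt0 : 0 < #|P|.
  rewrite lt0n; apply/negP => /eqP/card0_eq P0.
  have := longest_ending_at_gt0 i.
  by rewrite /longest_ending_at big_pred0 // => S; have := P0 S.
have [S /andP[S_mono S_end] S_max] := eq_bigmax_cond (fun S => #|S|) P_gt0.
by exists S; split; rewrite // -S_max.
Qed.

Hypothesis e_tr : transitive e.

(** Append [j] to a longest subsequence ending at [i]; transitivity relates its earlier entries to
    the one at [j]. *)
Lemma longest_ending_at_mono i j :
  i < j -> e (tnth A i) (tnth A j) ->
  longest_ending_at e A i < longest_ending_at e A j.
Proof.
move=> lt_ij e_ij.
have [S [/monotone_onP S_mono /ends_atP[iS S_le] <-]] := longest_ending_at_witness i.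
have jS : j \notin S by apply/negP => /S_le; rewrite leqNgt lt_ij.
have -> : #|S|.+1 = #|j |: S| by rewrite cardsU1 jS.
apply: leq_longest_ending_at.
  apply/monotone_onP => k l /setU1P[->|kS] /setU1P[->|lS]; first by rewrite ltnn.
  - by move=> lt_jl; have := leq_trans (ltn_trans lt_ij lt_jl) (S_le _ lS); rewrite ltnn.
  - move=> _; have [/val_inj -> //|nki] := eqVneq (k : nat) i.
    by apply: e_tr e_ij; apply: S_mono; rewrite // ltn_neqAle nki S_le.
  - exact: S_mono.
apply/ends_atP; split=> [|k /setU1P[-> //|/S_le le_ki]]; first exact: setU11.
exact: leq_trans le_ki (ltnW lt_ij).
Qed.

(** Delete [j] from a longest subsequence ending at [j]: the rest ends at its last position [i],
    which bounds the length at [i] from below. Monotonicity bounds it from above. *)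
Lemma longest_ending_at_pred j :
  1 < longest_ending_at e A j ->
  exists i, [/\ i < j, e (tnth A i) (tnth A j)
              & (longest_ending_at e A i).+1 = longest_ending_at e A j].
Proof.
have [S [/monotone_onP S_mono /ends_atP[jS S_le] S_card]] := longest_ending_at_witness j.
rewrite -S_card (cardsD1 j S) jS ltnS => /card_gt0P[i0 i0S].
case: (@arg_maxnP _ i0 (mem (S :\ j)) (@nat_of_ord n) i0S) => i iS' i_max.
have /setD1P[nij iS] := iS'.
have lt_ij : i < j by rewrite ltn_neqAle nij S_le.
have e_ij := S_mono _ _ iS jS lt_ij.
exists i; split=> //; apply/eqP; rewrite eqn_leq.
have := longest_ending_at_mono lt_ij e_ij.
rewrite -S_card (cardsD1 j S) jS => -> /=; rewrite ltnS.
apply: leq_longest_ending_at; last by apply/ends_atP.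
by apply/monotone_onP => k l /setD1P[_ kS] /setD1P[_ lS]; apply: S_mono.
Qed.

Lemma rank_spec_longest :
  rank_spec (fun i j => e (tnth A i) (tnth A j)) (longest_ending_at e A).
Proof.
split; [exact: longest_ending_at_gt0 | exact: longest_ending_at_mono |].
exact: longest_ending_at_pred.
Qed.

End Longest.

Lemma EST_eqP (R : realType) (n : nat) (A B : n.-tuple R) :
  EST A = EST B <->
  longest_incr A =1 longest_incr B /\ longest_decr A =1 longest_decr B.
Proof.
split=> [eqAB|[eqi eqd]]; last by apply: eq_from_tnth => i; rewrite !tnth_mktuple eqi eqd.
by split=> i; have := congr1 (fun t => tnth t i) eqAB; rewrite !tnth_mktuple => -[].
Qed.

(** The entry at [i] is the number of elements below [i] in [r]. *)
Lemma strict_linear_order_seq_order (R : realType) (n : nat) (r : rel 'I_n) :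
  strict_linear_order r -> exists2 A : n.-tuple R, uniq A & seq_order A = r.
Proof.
move=> [[r_irr r_tr] r_tot].
pose c i := #|[set j | r j i]|.
have c_mono i j : r i j -> c i < c j.
  move=> r_ij; apply/proper_card/properP; split.
    by apply/fintype.subsetP => k; rewrite !inE => r_ki; apply: r_tr r_ij.
  by exists i; rewrite !inE ?r_irr.
have c_lt i j : (c i < c j) = r i j.
  apply/idP/idP => [lt_c|/c_mono //].
  have nij : i <> j by move=> eq_ij; rewrite eq_ij ltnn in lt_c.
  by case/orP: (r_tot i j nij) => // /c_mono; rewrite ltnNge (ltnW lt_c).
exists [tuple (c i)%:R%R | i < n]; last first.
  apply/funext => i; apply/funext => j.
  by rewrite /seq_order !tnth_mktuple ltr_nat c_lt.
apply/tuple_uniqP => i j; rewrite !tnth_mktuple => /eqP; rewrite eqr_nat => /eqP eq_c.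
apply: contrapT => /r_tot.
by rewrite -!c_lt eq_c ltnn.
Qed.

Theorem theorem3 (R : realType) (n : nat) (T : n.-tuple (nat * nat)) :
  ESTs R n T -> EST_class R T = linear_extensions (order_poset R T).
Proof.
move=> [A uA <-{T}]; apply/seteqP; split=> r.
  move=> [B [uB eqBA] <-]; split; first exact: seq_order_strict_linear.
  by move=> i j /asboolP; apply; exists B.
move=> [r_lin r_ext].
have [B uB eqBr] := strict_linear_order_seq_order R r_lin.
exists B => //; split=> //; apply/EST_eqP.
have C_r i j : (forall E, EST_class R (EST A) E -> E i j) -> r i j.
  by move=> C_ij; apply: r_ext; apply/asboolP.
have CA : EST_class R (EST A) (seq_order A) by exists A.
have incr_spec : rank_spec r (longest_incr A).
  apply: (rank_spec_linear_extension (C := EST_class R (EST A))) => //.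
    by exists (seq_order A).
  move=> _ [D [uD /EST_eqP[/funext <- _]] <-].
  by split; [exact: seq_order_strict_linear | exact: rank_spec_longest lt_trans].
have gt_trans : transitive (>%R : rel R)%R by move=> y x z xy yz; apply: lt_trans yz xy.
have decr_spec : rank_spec (fun i j => r j i) (longest_decr A).
  (* Decreasing subsequences are increasing for the converse order, so the class is replaced by the
     converses of its members. *)
  pose C := [set E : rel 'I_n | EST_class R (EST A) (fun i j => E j i)]%classic.
  apply: (rank_spec_linear_extension (C := C)).
  - by exists (fun i j => seq_order A j i).
  - move=> E [D [uD /EST_eqP[_ /funext <-]] eqDE].
    have -> : E = fun i j => seq_order D j i.
      apply/funext => i; apply/funext => j.
      by rewrite eqDE.
    split; last exact: rank_spec_longest gt_trans.
    exact/strict_linear_order_converse/seq_order_strict_linear.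
  - exact: strict_linear_order_converse.
  - by move=> i j C_ij; apply: C_r => E CE; apply: (C_ij (fun i j => E j i)).
(* The lengths for [A] and for [B] are both rank functions of [r], or of its converse, hence
   equal. *)
split.
  apply: rank_spec_uniq incr_spec; rewrite -eqBr.
  exact: rank_spec_longest lt_trans.
apply: rank_spec_uniq decr_spec; rewrite -eqBr.
exact: rank_spec_longest gt_trans.
Qed.
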